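(* Let $(M,g)$ be a complete, non-compact Riemannian manifold with $\dim M\ge 2$, and let $\rho:M\to[0,+\infty)$ be a locally Lipschitz continuous function such that $B_r:=\{x\in M:\rho(x)<r\}$ is relatively compact in $M$ for every $r>0$ and $|\nabla\rho|\le 1$ almost everywhere on $M$. If $|M|<\infty$, then $$\liminf_{r\to+\infty}\frac{-\log\lambda_1(B_r)}{r}\ \ge\ \liminf_{r\to+\infty}\frac{-\log|M\setminus B_r|}{r}.$$
   Context: $dV$ is the Riemannian volume measure, $|E|$ is the Riemannian volume of $E\subset M$, and $\mathrm{Lip}_0(M)$ is the set of Lipschitz continuous functions on $M$ with compact support. For a relatively compact open set $\Omega\subset M$, $$\lambda_1(\Omega):=\inf\left\{\frac{\int_\Omega|\nabla\phi|^2dV}{\int_\Omega\phi^2dV}:\ \phi\in\mathrm{Lip}_0(M),\ \mathrm{supp}\,\phi\subset\overline\Omega,\ \phi\not\equiv0\right\},$$ with the convention $\lambda_1(\varnothing)=+\infty$. *)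

(* Defs.v *)
From HB Require Import structures.
From mathcomp Require Import all_boot all_order all_algebra.
From mathcomp Require Import all_classical all_reals all_analysis.

Set Implicit Arguments.
Unset Strict Implicit.
Unset Printing Implicit Defensive.

Import Order.TTheory GRing.Theory Num.Theory.
Import numFieldNormedType.Exports.

Local Open Scope classical_set_scope.
Local Open Scope ring_scope.

(** R^n is [n.-tuple R] with the product sigma-algebra, and its Lebesgue
    measure is the n-fold product of the one-dimensional one. *)

Section lebesgue_tuple.
Context {R : realType}.
Local Notation R_ := (measurableTypeR R).

Definition tcons n (x : R_ * n.-tuple R_) : n.+1.-tuple R_ :=
  [tuple of x.1 :: x.2].

Definition tuncons n (t : n.+1.-tuple R_) : R_ * n.-tuple R_ :=
  (tnth t ord0, [tuple of behead t]).

Lemma tconsK n : cancel (@tcons n) (@tuncons n).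
Proof. by case=> x t; congr pair; exact: val_inj. Qed.

Lemma measurable_tcons n : measurable_fun [set: _] (@tcons n).
Proof. exact: (measurable_cons measurable_fst measurable_snd). Qed.

Lemma measurable_tuncons n : measurable_fun [set: _] (@tuncons n).
Proof.
apply/measurable_fun_pairP; split; first exact: measurable_tnth.
exact: measurable_behead.
Qed.

Section step.
Variables (n : nat) (mu : {sigma_finite_measure set (n.-tuple R_) -> \bar R}).

Definition lebesgue_cons : set (n.+1.-tuple R_) -> \bar R :=
  pushforward (lebesgue_measure \x mu)%E (@tcons n).

Let lebesgue_cons0 : lebesgue_cons set0 = 0%E.
Proof. by rewrite /lebesgue_cons /pushforward preimage_set0 measure0. Qed.

Let lebesgue_cons_ge0 A : (0 <= lebesgue_cons A)%E.
Proof. by rewrite /lebesgue_cons /pushforward measure_ge0. Qed.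

Let lebesgue_cons_sigma_additive : semi_sigma_additive lebesgue_cons.
Proof.
move=> F mF tF mUF; rewrite /lebesgue_cons /pushforward preimage_bigcup.
have mcons A : measurable A -> measurable (@tcons n @^-1` A).
  by move=> mA; rewrite -[X in measurable X]setTI; exact: measurable_tcons.
apply: measure_semi_sigma_additive.
- by move=> k; exact: mcons.
- apply/trivIsetP => /= i j _ _ ij; rewrite -preimage_setI.
  by move/trivIsetP : tF => /(_ _ _ _ _ ij) ->//; rewrite preimage_set0.
- by rewrite -preimage_bigcup; exact: mcons.
Qed.

HB.instance Definition _ := isMeasure.Build _ _ _ lebesgue_cons
  lebesgue_cons0 lebesgue_cons_ge0 lebesgue_cons_sigma_additive.

Lemma sigma_finite_lebesgue_cons : sigma_finite setT lebesgue_cons.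
Proof.
have /sigma_finiteP[F [TF ndF Foo]] := sigma_finiteT (@lebesgue_measure R).
have /sigma_finiteP[G [TG ndG Goo]] := sigma_finiteT mu.
exists (fun k => @tuncons n @^-1` (F k `*` G k)).
  rewrite -preimage_bigcup -[LHS](preimage_setT (@tuncons n)); congr preimage.
  apply/seteqP; split => // -[x y] _.
  have [i _ Fix] : (\bigcup_i F i) x by rewrite -TF.
  have [j _ Gjy] : (\bigcup_i G i) y by rewrite -TG.
  exists (maxn i j) => //; split => /=.
  - by move: x Fix; exact/subsetPset/ndF/leq_maxl.
  - by move: y Gjy; exact/subsetPset/ndG/leq_maxr.
move=> k; have [mF Fk] := Foo k; have [mG Gk] := Goo k; split.
  by rewrite -[X in measurable X]setTI; apply: measurable_tuncons => //;
    exact: measurableX.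
rewrite /lebesgue_cons /pushforward -comp_preimage.
rewrite (_ : _ \o _ = id) ?preimage_id; last first.
  by apply/funext => x /=; rewrite tconsK.
by rewrite product_measure1E// lte_mul_pinfty// ge0_fin_numE.
Qed.

HB.instance Definition _ :=
  Measure_isSigmaFinite.Build _ _ _ lebesgue_cons sigma_finite_lebesgue_cons.

End step.

Fixpoint lebesgue_tuple n : {sigma_finite_measure set (n.-tuple R_) -> \bar R} :=
  if n is n'.+1 then lebesgue_cons (lebesgue_tuple n')
  else \d_ [tuple].

End lebesgue_tuple.

Definition row_of_tuple {R : realType} {n} (t : n.-tuple R) : 'rV[R]_n :=
  \row_i tnth t i.

(** C^k on [U], which is meant to be open. *)
Fixpoint Ck (R : realType) n (V : normedModType R) k
    (U : set 'rV[R]_n) (f : 'rV[R]_n -> V) : Prop :=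
  if k is k'.+1 then
    (forall u, U u -> differentiable f u) /\
    (forall i : 'I_n, Ck k' U ('D_(delta_mx ord0 i) f))
  else forall u, U u -> {for u, continuous f}.

Definition smooth (R : realType) n (V : normedModType R)
    (U : set 'rV[R]_n) (f : 'rV[R]_n -> V) : Prop :=
  forall k, Ck k U f.

(** [chart_fun] and [chart_inv] are total functions whose values outside
    [chart_dom] and [chart_image] are irrelevant. *)
Record chart (R : realType) (n : nat) (M : topologicalType) := Chart {
  chart_dom : set M ;
  chart_fun :> M -> 'rV[R]_n ;
  chart_inv : 'rV[R]_n -> M ;
  chart_dom_open : open chart_dom ;
  chart_image_open : open (chart_fun @` chart_dom) ;
  chart_funK : {in chart_dom, cancel chart_fun chart_inv} ;
  chart_continuous : {in chart_dom, continuous chart_fun} ;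
  chart_inv_continuous : {in chart_fun @` chart_dom, continuous chart_inv}
}.

Definition chart_image R n M (x : chart R n M) : set 'rV[R]_n :=
  x @` chart_dom x.

Record smooth_manifold (R : realType) (n : nat) (M : topologicalType) :=
    SmoothManifold {
  mfd_hausdorff : hausdorff_space M ;
  mfd_second_countable : @second_countable M ;
  atlas : set (chart R n M) ;
  atlas_cover : forall p, exists2 x, atlas x & chart_dom x p ;
  atlas_smooth : forall x y, atlas x -> atlas y ->
    smooth (x @` (chart_dom x `&` chart_dom y)) (y \o chart_inv x)
}.

(** [gram x u] is the matrix (g_ij) of the metric in the chart [x] at the point
    of coordinates [u]. Vectors are rows, so that a change of chart acts on
    them by right multiplication by the Jacobian matrix. *)
Record riemannian_manifold (R : realType) (n : nat) (M : topologicalType) :=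
    RiemannianManifold {
  mfd :> smooth_manifold R n M ;
  gram : chart R n M -> 'rV[R]_n -> 'M[R]_n ;
  gram_smooth : forall x, atlas mfd x -> smooth (chart_image x) (gram x) ;
  gram_sym : forall x u, atlas mfd x -> chart_image x u ->
    (gram x u)^T = gram x u ;
  gram_pos : forall x u, atlas mfd x -> chart_image x u ->
    forall v : 'rV[R]_n, v != 0 -> 0 < (v *m gram x u *m v^T) ord0 ord0 ;
  gram_change : forall x y p, atlas mfd x -> atlas mfd y ->
    chart_dom x p -> chart_dom y p ->
    let J := jacobian (y \o chart_inv x) (x p) in
    gram x (x p) = J *m gram y (y p) *m J^T
}.

Notation borel M := (g_sigma_algebraType (@open M)).

Section riemannian.
Context {R : realType} {n : nat} {M : ptopologicalType}.
Variable g : riemannian_manifold R n M.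

(** A tangent vector at [p] is represented by its components in the chart
    [chart_at p], chosen in the atlas. *)
Definition chart_at (p : M) : chart R n M := projT1 (cid2 (atlas_cover g p)).

Definition tangent_norm (p : M) (v : 'rV[R]_n) : R :=
  let x := chart_at p in
  Num.sqrt ((v *m gram g x (x p) *m v^T) ord0 ord0).

Definition in_coord (f : M -> R) (p : M) : 'rV[R]_n -> R :=
  f \o chart_inv (chart_at p).

Definition differentiable_at (f : M -> R) (p : M) : Prop :=
  differentiable (in_coord f p) (chart_at p p).

(** (grad f)^i = sum_j g^ij d_j f where [f] is differentiable; by convention
    [grad f] is 0 elsewhere, which for locally Lipschitz [f] is a null set. *)
Definition grad (f : M -> R) (p : M) : 'rV[R]_n :=
  let x := chart_at p in
  if `[< differentiable_at f p >] then
    (\row_i 'D_(delta_mx ord0 i) (in_coord f p) (x p)) *m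
      invmx (gram g x (x p))
  else 0.

Definition grad_norm (f : M -> R) (p : M) : R := tangent_norm p (grad f p).

Definition velocity (c : R -> M) (t : R) : 'rV[R]_n :=
  derive1 (chart_at (c t) \o c) t.

(** C^1 on the closed interval [0, 1], i.e. on a neighbourhood of each of its
    points. *)
Definition C1_curve (c : R -> M) : Prop :=
  forall t, t \in `[0, 1] ->
    let xc : R -> 'rV[R]_n := chart_at (c t) \o c in
    [/\ {for t, continuous c},
        \forall s \near t, derivable xc s 1 &
        {for t, continuous (derive1 xc)}].

Definition curve_length (c : R -> M) : \bar R :=
  (\int[lebesgue_measure]_(t in `[0%R, 1%R])
     (tangent_norm (c t) (velocity c t))%:E)%E.

(** A piecewise C^1 curve from [p] to [q], as the sequence of its pieces, each
    parametrized by [0, 1]. *)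
Fixpoint piecewise_C1 (p : M) (s : seq (R -> M)) (q : M) : Prop :=
  if s is c :: s' then
    [/\ C1_curve c, c 0 = p & piecewise_C1 (c 1) s' q]
  else p = q.

(** [+oo] between distinct connected components. *)
Definition rdist (p q : M) : \bar R :=
  ereal_inf [set (\sum_(c <- s) curve_length c)%E
            | s in [set s | piecewise_C1 p s q]].

Definition riemannian_complete : Prop :=
  forall u : nat -> M,
    (forall e : R, 0 < e ->
       exists N, forall i j, (N <= i)%N -> (N <= j)%N ->
         (rdist (u i) (u j) < e%:E)%E) ->
    exists l, forall e : R, 0 < e ->
      exists N, forall i, (N <= i)%N -> (rdist (u i) l < e%:E)%E.

Definition lipschitz_in (A : set M) (f : M -> R) : Prop :=
  exists2 K : R, 0 < K &
    forall p q, A p -> A q -> (`|f p - f q|%:E <= K%:E * rdist p q)%E.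

Definition locally_lipschitz (f : M -> R) : Prop :=
  forall p : M, exists2 U, nbhs p U & lipschitz_in U f.

(** The Borel measure given by sqrt(det g_ij) du in every chart. *)
Definition is_riemannian_volume
    (mu : {measure set (borel M) -> \bar R}) : Prop :=
  forall x, atlas g x ->
  forall E : set (borel M), measurable E -> E `<=` chart_dom x ->
    mu E = (\int[lebesgue_tuple n]_(t in row_of_tuple @^-1` (x @` E))
              (Num.sqrt (\det (gram g x (row_of_tuple t))))%:E)%E.

Definition support (f : M -> R) : set M := closure [set p | f p != 0].

Definition Lip0 (f : M -> R) : Prop :=
  lipschitz_in setT f /\ compact (support f).

(** [lambda1 dV set0 = +oo], as no [phi] qualifies. *)
Definition lambda1 (dV : {measure set (borel M) -> \bar R})
    (Omega : set M) : \bar R :=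
  ereal_inf
    [set ((\int[dV]_(p in Omega) (grad_norm phi p ^+ 2)%:E) /
          (\int[dV]_(p in Omega) (phi p ^+ 2)%:E))%E
    | phi in [set phi : M -> R | [/\ Lip0 phi,
                                     support phi `<=` closure Omega &
                                     exists p, phi p != 0]]].

End riemannian.

(* Main.v *)
Require Import Defs.
From mathcomp Require Import all_boot all_order all_algebra.
From mathcomp Require Import all_classical all_reals all_analysis.
From mathcomp Require Import measurable_realfun ring lra.

Import Order.TTheory GRing.Theory Num.Theory.
Import numFieldNormedType.Exports.
Local Open Scope classical_set_scope.
Local Open Scope ring_scope.

Set Implicit Arguments.
Unset Strict Implicit.
Unset Printing Implicit Defensive.

(** The proof tests [lambda1 (B r)] on [phi = min 1 (max 0 (r - rho))]
    ([cutoff]). This function equals 1 where [rho <= r - 1], is nonzero exactly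
    on [B r], and its gradient has norm at most 1 almost everywhere and vanishes
    on [B (r - 1)]. Writing [V r] for the volume of the complement of [B r],
    one gets (lemmas [lambda1_le_ratio], [cutoff_energy], [cutoff_mass])

      lambda1 (B r) <= V (r - 1) / |B (r - 1)| <= V (r - 1) / m

    for [r >= r0 + 1], where [m = |B r0|] is positive. Passing to logarithms and
    dividing by [r], neither the shift of [r] by 1 nor the constant [m] affects
    the lower limits ([limf_einf_rate_shift]). If every [B r] is a null set,
    then the energy of [phi] is zero, so that [lambda1 (B r) <= 0] and the
    right-hand side is +oo.

    What remains is to show that [phi] is admissible, that is, globally
    Lipschitz for the Riemannian distance, and that the sets [B r] are
    measurable.

    - Measurability follows from the continuity of [rho]
      ([locally_lipschitz_continuous]): near a point, the distance is bounded by
      a multiple of the coordinate distance, because a straight segment in a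
      chart is a C^1 curve of controlled length ([rdist_le_chart]).
    - On the compact closure of [B r] the local Lipschitz constants of [rho] may
      be taken uniform, and [phi] is zero outside of it, so [phi] is locally
      [K]-Lipschitz with a single [K]. Such a function is [K]-Lipschitz
      ([locally_uniformly_lipschitz]): along a curve, the local bounds are
      chained over small subintervals, the distance between the end points of a
      subcurve being at most the integral of the speed ([rdist_le_subcurve]).

    Both points use that the speed of a curve does not depend on the chart in
    which it is computed ([speedE]) and is continuous ([continuous_speed]). *)

(** * Monotonicity of the integral *)

Section integral_monotone.
Local Open Scope ereal_scope.
Context d (T : measurableType d) (R : realType).
Variable mu : {measure set T -> \bar R}.

Import HBNNSimple.

(** Monotonicity of the integral of nonnegative functions, with no
    measurability assumption: the integral is a supremum over the simple
    functions below the integrand. *)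
Lemma ge0_le_integral_nomeas (D1 D2 : set T) (f1 f2 : T -> \bar R) :
  (forall x, D1 x -> 0 <= f1 x) -> (forall x, D2 x -> 0 <= f2 x) ->
  (forall x, (f1 \_ D1) x <= (f2 \_ D2) x) ->
  \int[mu]_(x in D1) f1 x <= \int[mu]_(x in D2) f2 x.
Proof.
move=> f10 f20 f12; rewrite (integral_mkcond D1) (integral_mkcond D2).
rewrite !ge0_integralTE; last 2 first.
- by move=> x; exact: erestrict_ge0.
- by move=> x; exact: erestrict_ge0.
apply: ereal_sup_le => _ [h hf1 <-]; exists h => // x.
exact: le_trans (hf1 x) (f12 x).
Qed.

End integral_monotone.

(** * The metric and the speed of curves in charts *)

Section quadratic_form.
Context {R : realType} {n : nat}.

(** The value at the row vector [w] of the quadratic form of matrix [G]. *)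
Definition quad (G : 'M[R]_n) (w : 'rV[R]_n) : R := (w *m G *m w^T) ord0 ord0.

Lemma quadE G w : quad G w = \sum_(j < n) (\sum_(i < n) w ord0 i * G i j) * w ord0 j.
Proof.
by rewrite /quad mxE; apply: eq_bigr => j _; rewrite !mxE.
Qed.

Lemma quadZ G (a : R) w : quad G (a *: w) = a ^+ 2 * quad G w.
Proof. by rewrite /quad linearZ/= -!scalemxAl -scalemxAr !mxE mulrA. Qed.

Lemma cvg_quad (T : Type) (F : set_system T) (FF : Filter F)
    (G : T -> 'M[R]_n) (w : T -> 'rV[R]_n) G0 w0 :
  G x @[x --> F] --> G0 -> w x @[x --> F] --> w0 ->
  quad (G x) (w x) @[x --> F] --> quad G0 w0.
Proof.
move=> GG0 ww0; rewrite quadE; under eq_cvg do rewrite quadE.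
have wc i : w x ord0 i @[x --> F] --> w0 ord0 i.
  by have := @coord_continuous R 1 n ord0 i w0; exact: cvg_comp.
have Gc i j : G x i j @[x --> F] --> G0 i j.
  by have := @coord_continuous R n n i j G0; exact: cvg_comp.
apply: cvg_big => [|j _]; first exact: add_continuous.
apply: cvgM => //.
by apply: cvg_big => [|i _]; [exact: add_continuous|exact: cvgM].
Qed.

End quadratic_form.

Section charts.
Context {R : realType} {n : nat} {M : ptopologicalType}.
Variable g : riemannian_manifold R n M.

Lemma atlas_chart_at p : atlas g (chart_at g p).
Proof. by rewrite /chart_at; case: cid2. Qed.

Lemma chart_dom_chart_at p : chart_dom (chart_at g p) p.
Proof. by rewrite /chart_at; case: cid2. Qed.

Lemma chart_imageP (x : chart R n M) p : chart_dom x p -> chart_image x (x p).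
Proof. by move=> xp; exists p. Qed.

Lemma chartK (x : chart R n M) p : chart_dom x p -> chart_inv x (x p) = p.
Proof. by move=> xp; apply: (chart_funK (c := x)); rewrite inE. Qed.

Lemma chart_cvg (x : chart R n M) p : chart_dom x p -> x q @[q --> p] --> x p.
Proof. by move=> xp; apply: (chart_continuous (c := x)); rewrite inE. Qed.

Lemma chart_inv_cvg (x : chart R n M) u : chart_image x u ->
  chart_inv x v @[v --> u] --> chart_inv x u.
Proof. by move=> xp; apply: (chart_inv_continuous (c := x)); rewrite inE. Qed.

Lemma near_chart_dom (x : chart R n M) p : chart_dom x p ->
  \forall q \near p, chart_dom x q.
Proof. by move=> xp; exact/open_nbhs_nbhs/(conj (chart_dom_open x) xp). Qed.

Lemma near_chart_image (x : chart R n M) u : chart_image x u ->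
  \forall v \near u, chart_image x v.
Proof. by move=> xp; apply: open_nbhs_nbhs; split=> //; exact: chart_image_open. Qed.

Lemma chart_change_smooth (x y : chart R n M) p : atlas g x -> atlas g y ->
  chart_dom x p -> chart_dom y p ->
  differentiable (y \o chart_inv x) (x p) /\
  forall i, {for x p, continuous ('D_(delta_mx ord0 i) (y \o chart_inv x))}.
Proof.
move=> ax ay xp yp; have /(_ 1%N) /= [dif con] := atlas_smooth (s := g) ax ay.
have U : (x @` (chart_dom x `&` chart_dom y)) (x p) by exists p.
split; first exact: dif.
by move=> i; exact: con.
Qed.

(** A change of charts multiplies the velocity of a curve by the Jacobian matrix. *)
Lemma derivative_chart_change (x y : chart R n M) (c : R -> M) s :
  atlas g x -> atlas g y -> chart_dom x (c s) -> chart_dom y (c s) ->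
  {for s, continuous c} -> derivable (x \o c : R -> 'rV[R]_n) s 1 ->
  derivable (y \o c : R -> 'rV[R]_n) s 1 /\
  derive1 (y \o c) s =
    derive1 (x \o c) s *m jacobian (y \o chart_inv x) (x (c s)).
Proof.
move=> ax ay xc yc cc dxc.
have [dyx _] := chart_change_smooth ax ay xc yc.
have E : {near s, (y \o chart_inv x) \o (x \o c) =1 y \o c}.
  have : \forall t \near s, chart_dom x (c t) by apply: cc; exact: near_chart_dom.
  by apply: filterS => t xt /=; rewrite chartK.
have dxc' : differentiable (x \o c) s by exact/derivable1_diffP.
have dcomp : differentiable ((y \o chart_inv x) \o (x \o c)) s.
  exact: differentiable_comp.
split.
  by apply: near_eq_derivable E _; exact/derivable1_diffP.
rewrite !derive1E -(near_eq_derive _ E) deriveE// diff_comp//= -deriveE//.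
by rewrite -[in LHS]deriveE// derivemxE.
Qed.

(** The speed of a curve may be computed in any chart of the atlas, and not
    only in the one chosen by [chart_at]. *)
Lemma speedE (x : chart R n M) (c : R -> M) s : atlas g x ->
  chart_dom x (c s) -> {for s, continuous c} ->
  derivable (x \o c : R -> 'rV[R]_n) s 1 ->
  tangent_norm g (c s) (velocity g c s) =
  Num.sqrt (quad (gram g x (x (c s))) (derive1 (x \o c) s)).
Proof.
move=> ax xc cc dxc; rewrite /tangent_norm /velocity.
set y := chart_at g (c s).
have ay : atlas g y by exact: atlas_chart_at.
have yc : chart_dom y (c s) by exact: chart_dom_chart_at.
have [_ ->] := derivative_chart_change ax ay xc yc cc dxc.
rewrite (gram_change ax ay xc yc) /quad; congr (Num.sqrt (_ ord0 ord0)).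
by rewrite trmx_mul !mulmxA.
Qed.

Lemma continuous_gram (x : chart R n M) u : atlas g x -> chart_image x u ->
  {for u, continuous (gram g x)}.
Proof. by move=> ax xu; exact: (gram_smooth ax 0%N). Qed.

(** The chart used in [velocity] jumps with the point of the curve; around a
    given time, [speedE] replaces it by a fixed chart. *)
Lemma continuous_speed (c : R -> M) t : C1_curve g c -> t \in `[0, 1] ->
  {for t, continuous (fun s => tangent_norm g (c s) (velocity g c s))}.
Proof.
move=> /[apply] -[]; set x := chart_at g (c t) => cc dxc cdxc.
have ax : atlas g x by exact: atlas_chart_at.
have xc : chart_dom x (c t) by exact: chart_dom_chart_at.
have near_dom : \forall s \near t, chart_dom x (c s).
  by apply: cc; exact: near_chart_dom.
(* [C1_curve] asserts the continuity of [c] on [0, 1] only, which does not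
   include a neighbourhood of an end point; but near [t] the coordinates of [c]
   are derivable, hence continuous, and they determine [c]. *)
have near_cont : \forall s \near t, {for s, continuous c}.
  have := near_join near_dom; apply: filter_app; apply: filter_app near_dom.
  move: dxc; apply: filterS => s dxs xs nxs.
  have xcs : {for s, continuous (x \o c : R -> 'rV[R]_n)}.
    by apply: differentiable_continuous; exact/derivable1_diffP.
  have E : {near s, chart_inv x \o (x \o c) =1 c}.
    by move: nxs; apply: filterS => s' xs' /=; rewrite chartK.
  have inv_xcs : chart_inv x v @[v --> x (c s)] --> c s.
    by rewrite -[X in _ --> X](chartK xs); apply: chart_inv_cvg; exists (c s).
  by apply: cvg_trans (near_eq_cvg E) _; apply: cvg_comp xcs inv_xcs.
pose speed s := tangent_norm g (c s) (velocity g c s).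
pose speed_x s := Num.sqrt (quad (gram g x (x (c s))) (derive1 (x \o c) s)).
have E : {near t, speed_x =1 speed}.
  move: near_cont; apply: filter_app; move: near_dom; apply: filter_app.
  by move: dxc; apply: filterS => s dxs xs cs; rewrite /speed (speedE ax xs cs dxs).
suff speed_x_cvg : speed_x s @[s --> t] --> speed_x t.
  have Et : speed t = speed_x t := esym (nbhs_singleton E).
  change (speed s @[s --> t] --> speed t).
  by rewrite Et; apply: cvg_trans speed_x_cvg; exact: near_eq_cvg E.
have quad_cvg : quad (gram g x (x (c s))) (derive1 (x \o c) s) @[s --> t] -->
    quad (gram g x (x (c t))) (derive1 (x \o c) t).
  apply: cvg_quad; last exact: cdxc.
  apply: (@cvg_comp _ _ _ (fun s => x (c s)) (gram g x)); last first.
    exact: (continuous_gram ax (chart_imageP xc)).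
  by apply: cvg_comp cc _; exact: chart_cvg.
by apply: cvg_comp quad_cvg _; exact: sqrt_continuous.
Qed.

End charts.

(** * Straight segments in charts and continuity of locally Lipschitz functions *)

Section segments.
Context {R : realType} {n : nat} {M : ptopologicalType}.
Variable g : riemannian_manifold R n M.

Lemma quad_le (G : 'M[R]_n) (w : 'rV[R]_n) :
  quad G w <= (n * n)%:R * `|G| * `|w| ^+ 2.
Proof.
have entry m k (A : 'M[R]_(m, k)) i j : `|A i j| <= `|A|.
  by rewrite [leRHS]/Num.Def.normr/= mx_normrE; apply: (le_bigmax _ _ (i, j)).
have -> : (n * n)%:R * `|G| * `|w| ^+ 2 =
    \sum_(j < n) (\sum_(i < n) `|w| * `|G|) * `|w|.
  rewrite !sumr_const !card_ord -mulr_natl natrM expr2; ring.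
rewrite quadE; apply: ler_sum => j _.
apply: le_trans (ler_norm _) _; rewrite normrM; apply: ler_pM => //.
apply: le_trans (ler_norm_sum _ _ _) _; apply: ler_sum => i _.
by rewrite normrM; apply: ler_pM.
Qed.

Section segment.
Variables (x : chart R n M) (u v : 'rV[R]_n).
Hypothesis ax : atlas g x.
Hypothesis image_uv : forall t : R, t \in `[0, 1] -> chart_image x (u + t *: v).
Let line (t : R) : 'rV[R]_n := u + t *: v.
Let c (t : R) : M := chart_inv x (line t).

Let line_diff (t : R) : differentiable line t /\ 'D_1 line t = v.
Proof.
have dl : is_diff t (cst u + *:%R^~ v : R -> 'rV[R]_n) (0 + *:%R^~ v).
  exact: is_diffD.
have -> : line = cst u + *:%R^~ v by exact/funext.
split; first exact: ex_diff.
by rewrite deriveE; [rewrite diff_val fctE/= add0r scale1r|exact: ex_diff].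
Qed.

Let line_cvg (t : R) : line s @[s --> t] --> line t.
Proof. exact/differentiable_continuous/(line_diff t).1. Qed.

Let near_image (t : R) : t \in `[0, 1] -> \forall s \near t, chart_image x (line s).
Proof.
by move=> t01; apply: line_cvg; apply: near_chart_image; exact: image_uv.
Qed.

Let domE (s : R) : chart_image x (line s) -> chart_dom x (c s) /\ x (c s) = line s.
Proof. by rewrite /c => -[p xp <-]; rewrite chartK. Qed.

Let c_cvg (s : R) : chart_image x (line s) -> c s' @[s' --> s] --> c s.
Proof. by move=> ims; exact: (cvg_comp _ _ (@line_cvg s) (chart_inv_cvg ims)). Qed.

Let derivable_xc (t : R) : t \in `[0, 1] -> \forall s \near t,
  chart_image x (line s) /\
  (derivable (x \o c : R -> 'rV[R]_n) s 1 /\ derive1 (x \o c) s = v).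
Proof.
move=> /near_image im; have := near_join im; apply: filter_app.
move: im; apply: filterS => s ims nims; split=> //.
have E : {near s, line =1 x \o c}.
  by move: nims; apply: filterS => s' /domE[_ /= ->].
split; last by rewrite derive1E -(near_eq_derive _ E) (line_diff s).2.
by apply: near_eq_derivable E _; apply/derivable1_diffP; exact: (line_diff s).1.
Qed.

(** [chart_at (c t)] need not be [x]: in that chart the derivative of [c] is a
    combination of the partial derivatives of the change of charts, which are
    continuous. *)
Lemma segment_C1 : C1_curve g c.
Proof.
move=> t t01; set y := chart_at g (c t).
have imt : chart_image x (line t) by exact: image_uv.
have [xct xcE] := domE imt.
have ay : atlas g y by exact: atlas_chart_at.
have yct : chart_dom y (c t) by exact: chart_dom_chart_at.
pose f := y \o chart_inv x.
have near_y : \forall s \near t, chart_dom y (c s).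
  by apply: c_cvg => //; exact: near_chart_dom.
have deriv_yc : \forall s \near t, derivable (y \o c : R -> 'rV[R]_n) s 1 /\
    derive1 (y \o c) s = \sum_(i < n) v ord0 i *: 'D_(delta_mx ord0 i) f (line s).
  move: near_y; apply: filter_app.
  move: (derivable_xc t01); apply: filterS => s [ims [dxc Dxc]] ycs.
  have [xcs xcsE] := domE ims.
  have [dyc ->] := derivative_chart_change ax ay xcs ycs (c_cvg ims) dxc.
  have [df _] := chart_change_smooth ax ay xcs ycs.
  split=> //; rewrite Dxc mulmx_sum_row; apply: eq_bigr => i _; congr (_ *: _).
  by rewrite rowE -xcsE derivemxE.
split.
- exact: c_cvg.
- by move: deriv_yc; apply: filterS => s [].
- pose D s := \sum_(i < n) v ord0 i *: 'D_(delta_mx ord0 i) f (line s).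
  have E : {near t, D =1 derive1 (y \o c)}.
    by move: deriv_yc; apply: filterS => s [].
  change (derive1 (y \o c) s @[s --> t] --> derive1 (y \o c) t).
  rewrite -(nbhs_singleton E : D t = _).
  suff : D s @[s --> t] --> D t by apply: cvg_trans; exact: near_eq_cvg E.
  have [_ cf] := chart_change_smooth ax ay xct yct.
  apply: cvg_big => [|i _]; first exact: add_continuous.
  apply: cvgZr; have := cf i; rewrite xcE; apply: cvg_comp; exact: line_cvg.
Qed.

Lemma segment_speed (t : R) : t \in `[0, 1] ->
  tangent_norm g (c t) (velocity g c t) =
  Num.sqrt (quad (gram g x (u + t *: v)) v).
Proof.
move=> t01; have [ims [dxc Dxc]] := nbhs_singleton (derivable_xc t01).
have [xct xcE] := domE ims.
by rewrite (speedE ax xct (c_cvg ims) dxc) Dxc xcE.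
Qed.

End segment.

End segments.

Section continuity.
Context {R : realType} {n : nat} {M : ptopologicalType}.
Variable g : riemannian_manifold R n M.

Lemma curve_length_le (c : R -> M) (K : R) :
  (forall t, t \in `[0, 1] -> tangent_norm g (c t) (velocity g c t) <= K) ->
  (curve_length g c <= K%:E)%E.
Proof.
move=> cK; have K0 : 0 <= K.
  by apply: le_trans (sqrtr_ge0 _) (cK 0 _); rewrite in_itv/= lexx ler01.
apply: (@le_trans _ _ (\int[lebesgue_measure]_(t in `[0%R, 1%R]) K%:E)%E).
  apply: ge0_le_integral_nomeas => t.
  - by rewrite lee_fin sqrtr_ge0.
  - by rewrite lee_fin.
  - by rewrite !patchE; case: ifPn => // /set_mem t01; rewrite lee_fin cK.
rewrite integral_cst//= lebesgue_measure_itv/= lte_fin ltr01.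
by rewrite sube0 mule1.
Qed.

Lemma rdist_le_curve (c : R -> M) p q : C1_curve g c -> c 0 = p -> c 1 = q ->
  (rdist g p q <= curve_length g c)%E.
Proof.
move=> C1 c0 c1; apply: ereal_inf_lbound => /=; exists [:: c] => //=.
by rewrite big_seq1.
Qed.

(** The topology of [M] is finer than that of the Riemannian distance. *)
Lemma rdist_le_chart p : let x := chart_at g p in
  exists2 C : R, 0 <= C &
    \forall q \near p, (rdist g p q <= (C * `|x q - x p|)%:E)%E.
Proof.
move=> x; have ax : atlas g x by exact: atlas_chart_at.
have xp : chart_dom x p by exact: chart_dom_chart_at.
have imp := chart_imageP xp.
pose A := `|gram g x (x p)| + 1.
have near_bound : \forall u \near x p, `|gram g x u| <= A.
  have := continuous_gram ax imp => /cvgr_dist_lt /(_ 1 ltr01).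
  apply: filterS => u; rewrite distrC => /ltW h.
  by rewrite -lerBlDl; apply: le_trans h; exact: lerB_dist.
have : \forall u \near x p, chart_image x u /\ `|gram g x u| <= A.
  by apply: filterI => //; exact: near_chart_image.
move=> /nbhs_ballP[e /= e0 he].
have near_e : \forall q \near p, `|x p - x q| < e.
  by have := chart_cvg xp => /cvgr_dist_lt /(_ e e0).
pose C := Num.sqrt ((n * n)%:R * A).
exists C; first exact: sqrtr_ge0.
move: near_e; apply: filter_app; move: (near_chart_dom xp).
apply: filterS => q xq qe; pose v := x q - x p.
have seg (t : R) : t \in `[0, 1] -> ball (x p) e (x p + t *: v).
  rewrite in_itv/= => /andP[t0 t1]; rewrite -ball_normE/= opprD addNKr normrN.
  rewrite normrZ ger0_norm//; apply: le_lt_trans qe; rewrite distrC.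
  by rewrite ler_piMl.
have im (t : R) : t \in `[0, 1] -> chart_image x (x p + t *: v).
  by move=> /seg/he[].
pose c t := chart_inv x (x p + t *: v).
apply: (@le_trans _ _ (curve_length g c)).
  apply: rdist_le_curve; first exact: segment_C1.
    by rewrite /c scale0r addr0 chartK.
  by rewrite /c scale1r /v addrC subrK chartK.
apply: curve_length_le => t t01; rewrite segment_speed//.
rewrite -[leRHS]ger0_norm ?mulr_ge0 ?sqrtr_ge0// -sqrtr_sqr.
apply: ler_wsqrtr; rewrite exprMn sqr_sqrtr; last first.
  by rewrite mulr_ge0// addr_ge0.
apply: le_trans (quad_le _ _) _; rewrite ler_wpM2r ?exprn_ge0//.
by rewrite ler_wpM2l//; have /he[] := seg _ t01.
Qed.

Lemma locally_lipschitz_continuous (f : M -> R) :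
  locally_lipschitz g f -> continuous f.
Proof.
move=> lf p; have [U Up [K K0 fK]] := lf p.
have Up0 := nbhs_singleton Up.
have [C C0 pC] := rdist_le_chart p.
set x := chart_at g p in pC.
have xp : chart_dom x p by exact: chart_dom_chart_at.
apply/cvgrPdist_lt => e e0.
have d0 : 0 < e / (K * (C + 1)) by rewrite divr_gt0// mulr_gt0// ltr_wpDl.
have := chart_cvg xp => /cvgr_dist_lt /(_ _ d0).
apply: filter_app; move: pC; apply: filter_app; move: Up; apply: filterS.
move=> q Uq pq; rewrite distrC => xq.
have := fK _ _ Up0 Uq => /le_trans.
move=> /(_ (K * (C * `|x q - x p|))%:E); rewrite lee_fin => h.
apply: le_lt_trans (h _) _.
  by rewrite EFinM; apply: lee_wpmul2l => //; rewrite lee_fin ltW.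
move: xq; rewrite ltr_pdivlMr ?mulr_gt0 ?ltr_wpDl// => xq.
apply: le_lt_trans xq; rewrite mulrA [leRHS]mulrC ler_wpM2r//.
by rewrite ler_wpM2l ?(ltW K0)// lerDl.
Qed.

End continuity.

(** * Chaining along an interval and subcurves *)

Section interval_chaining.
Context {R : realType}.

(** A transitive relation between the end points of subintervals of [0, 1] that
    holds for all small intervals around each point holds between 0 and 1: the
    supremum of the points reached from 0 is 1. *)
Lemma interval_chaining (P : R -> R -> Prop) :
  (forall a b c, 0 <= a -> a <= b -> b <= c -> c <= 1 ->
     P a b -> P b c -> P a c) ->
  (forall t, t \in `[0, 1] -> exists2 d, 0 < d &
     forall a b, 0 <= a -> a <= t -> t <= b -> b <= 1 ->
       t - a < d -> b - t < d -> P a b) ->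
  P 0 1.
Proof.
move=> Ptrans Ploc.
pose S := [set t : R | [/\ 0 <= t, t <= 1 & P 0 t]].
have S0 : S 0.
  have [|d d0 h] := Ploc 0; first by rewrite in_itv/= lexx ler01.
  by split=> //; apply: h; rewrite ?subrr.
have hS : has_sup S by split; [exists 0|exists 1 => t []].
set m := sup S.
have m0 : 0 <= m by apply: ub_le_sup => //; case: hS.
have m1 : m <= 1 by apply: ge_sup; [exists 0|move=> t []].
have [|d d0 h] := Ploc m; first by rewrite in_itv/= m0 m1.
have [s [s0 s1 Ps] ms] := sup_adherent d0 hS.
have sm : s <= m by apply: ub_le_sup; [case: hS|].
pose b := Num.min 1 (m + d / 2).
have b1 : b <= 1 by rewrite ge_min lexx.
have mb : m <= b by rewrite le_min m1 lerDl divr_ge0// ltW.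
have bd : b - m < d.
  rewrite ltrBlDl gt_min; apply/orP; right.
  by rewrite ltrD2l ltr_pdivrMr// ltr_pMr// ltr1n.
have Pb : P 0 b.
  apply: (Ptrans _ s) => //; first exact: le_trans sm mb.
  by apply: h => //; rewrite ltrBlDr addrC -ltrBlDr.
have bm : b <= m.
  by apply: ub_le_sup; [case: hS|split=> //; exact: le_trans mb].
suff <- : b = 1 by [].
move: bm; rewrite /b /Num.min; case: ifPn => // _.
by rewrite gerDl leNgt divr_gt0.
Qed.

End interval_chaining.

Section subcurve.
Context {R : realType} {n : nat} {M : ptopologicalType}.
Variable g : riemannian_manifold R n M.

Section affine.
Variables (a b : R).
Let l (t : R) : R := a + t * (b - a).

Lemma affine_is_derive (t : R) : is_derive t (1 : R) l (b - a).
Proof.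
have -> : l = cst a + (b - a) *: id.
  by apply/funext => s; rewrite /l mulrC.
have := is_deriveD (is_derive_cst a t 1) (is_deriveZ (b - a) (is_derive_id t 1)).
by rewrite add0r [X in is_derive _ _ _ X]mulr1.
Qed.

Lemma affine_cvg (t : R) : l s @[s --> t] --> l t.
Proof.
apply/differentiable_continuous/derivable1_diffP.
by have := affine_is_derive t => -[].
Qed.

Lemma affine_near (P : set R) (t : R) :
  (\forall u \near l t, P u) -> \forall s \near t, P (l s).
Proof. by move=> Plt; exact: (@affine_cvg t P Plt). Qed.

Lemma affine_comp (V : normedModType R) (f : R -> V) (t : R) :
  derivable f (l t) 1 ->
  derivable (f \o l) t 1 /\ derive1 (f \o l) t = (b - a) *: derive1 f (l t).
Proof.
move=> /derivable1_diffP df; have [dl Dl] := affine_is_derive t.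
have {}dl : differentiable l t by exact/derivable1_diffP.
have dfl : differentiable (f \o l) t by exact: differentiable_comp.
split; first exact/derivable1_diffP.
rewrite !derive1E deriveE// diff_comp//= -(deriveE _ dl) Dl.
by rewrite deriveE// -[in LHS](mulr1 (b - a)) [in LHS]linearZ.
Qed.

End affine.

Variables (c : R -> M) (a b : R).
Hypotheses (Cc : C1_curve g c) (a0 : 0 <= a) (ab : a <= b) (b1 : b <= 1).
Let l (t : R) : R := a + t * (b - a).
Let ba : 0 <= b - a. Proof. by rewrite subr_ge0. Qed.

Let l01 (t : R) : t \in `[0, 1] -> l t \in `[0, 1].
Proof.
rewrite !in_itv/= => /andP[t0 t1]; apply/andP; split.
  by rewrite addr_ge0// mulr_ge0.
by apply: le_trans b1; rewrite -lerBrDl ler_piMl.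
Qed.

Lemma subcurve_C1 : C1_curve g (c \o l).
Proof.
move=> t t01; have [cc dc cdc] := Cc (l01 t01).
set x := chart_at g (c (l t)) in cc dc cdc *.
have ndx : \forall s \near t, derivable (x \o c : R -> 'rV[R]_n) (l s) 1.
  exact: affine_near dc.
split.
- exact: (cvg_comp _ _ (@affine_cvg a b t) cc).
- by move: ndx; apply: filterS => s /(affine_comp (a := a) (b := b))[].
- pose D s := (b - a) *: derive1 (x \o c) (l s).
  have E : {near t, D =1 derive1 (x \o c \o l)}.
    by move: ndx; apply: filterS => s /(affine_comp (a := a) (b := b))[].
  change (derive1 (x \o c \o l) s @[s --> t] --> derive1 (x \o c \o l) t).
  rewrite -(nbhs_singleton E : D t = _).
  suff : D s @[s --> t] --> D t by apply: cvg_trans; exact: near_eq_cvg E.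
  apply: cvgZr; exact: (cvg_comp _ _ (@affine_cvg a b t) cdc).
Qed.

Lemma subcurve_speed (t : R) : t \in `[0, 1] ->
  tangent_norm g ((c \o l) t) (velocity g (c \o l) t) =
  tangent_norm g (c (l t)) (velocity g c (l t)) * (b - a).
Proof.
move=> t01; have [cc dc cdc] := Cc (l01 t01).
have [_ Dv] := affine_comp (nbhs_singleton dc).
rewrite /tangent_norm /velocity Dv -/(quad _ _) quadZ sqrtrM ?sqr_ge0//.
by rewrite sqrtr_sqr ger0_norm// mulrC.
Qed.

End subcurve.

(** * From uniform local to global Lipschitz bounds *)

Section global_lipschitz.
Context {R : realType}.
Local Notation mu := (@lebesgue_measure R).

Lemma integral_affine (f : R -> R) (a b : R) : a <= b ->
  {within `[a, b], continuous f} ->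
  (\int[mu]_(t in `[0%R, 1%R]) (f (a + t * (b - a)) * (b - a))%:E =
   \int[mu]_(t in `[a, b]) (f t)%:E)%E.
Proof.
rewrite le_eqVlt => /predU1P[->|ab] cf.
  rewrite set_itv1 integral_set1; under eq_integral do rewrite subrr mulr0.
  exact: integral0.
pose l (t : R) := a + t * (b - a).
have dl : derive1 l = cst (b - a).
  by apply/funext => t; rewrite derive1E; have [_] := affine_is_derive a b t.
have l0 : l 0 = a by rewrite /l mul0r addr0.
have l1 : l 1 = b by rewrite /l mul1r addrC subrK.
have cl (t : R) : l s @[s --> t] --> l t := @affine_cvg R a b t.
have := @integration_by_substitution_increasing R l f 0 1 ler01.
rewrite l0 l1 => ->//.
- by rewrite dl.
- move=> s t _ _ st; rewrite /l ltrD2l ltr_pM2r// subr_gt0//.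
- by rewrite dl => z _; exact: cvg_cst.
- by rewrite dl; exact: is_cvg_cst.
- by rewrite dl; exact: is_cvg_cst.
- split.
  + by move=> t _; have [] := affine_is_derive a b t.
  + by apply: cvg_at_right_filter; exact: cl.
  + by apply: cvg_at_left_filter; exact: cl.
Qed.

Lemma integral_itv_split (f : R -> R) (a b c : R) : a <= b -> b <= c ->
  {within `[a, c], continuous f} -> (forall t, 0 <= f t) ->
  (\int[mu]_(t in `[a, c]) (f t)%:E =
   \int[mu]_(t in `[a, b]) (f t)%:E + \int[mu]_(t in `[b, c]) (f t)%:E)%E.
Proof.
move=> ab bc cf f0.
have mf0 : measurable_fun `[a, c] f.
  exact: subspace_continuous_measurable_fun.
have mf := (measurable_EFinP _ _).2 mf0.
have E : `[a, c]%classic = `[a, b]%classic `|` `]b, c]%classic.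
  by rewrite -itv_bndbnd_setU//= bnd_simp.
rewrite E ge0_integral_setU//=.
- congr (_ + _)%E; apply: integral_itv_obnd_cbnd.
  by apply: measurable_funS mf => //; rewrite E; exact: subsetUr.
- by rewrite -E.
- by move=> t _; rewrite lee_fin.
- rewrite disj_set2E; apply/eqP/seteqP; split=> // t [] /=.
  rewrite !in_itv/= => /andP[_ tb] /andP[bt _].
  by have := le_lt_trans tb bt; rewrite ltxx.
Qed.

Context {n : nat} {M : ptopologicalType}.
Variable g : riemannian_manifold R n M.

Let speed (c : R -> M) (t : R) : R := tangent_norm g (c t) (velocity g c t).

Let speed_continuous (c : R -> M) (a b : R) : C1_curve g c -> 0 <= a -> b <= 1 ->
  {within `[a, b], continuous (speed c)}.
Proof.
move=> Cc a0 b1; apply: continuous_in_subspaceT => t /set_mem/=.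
rewrite in_itv/= => /andP[at_ tb]; apply: continuous_speed => //.
by rewrite in_itv/= (le_trans a0)// (le_trans tb).
Qed.

Lemma rdist_le_subcurve (c : R -> M) (a b : R) : C1_curve g c ->
  0 <= a -> a <= b -> b <= 1 ->
  (rdist g (c a) (c b) <= \int[mu]_(t in `[a, b]) (speed c t)%:E)%E.
Proof.
move=> Cc a0 ab b1; pose l (t : R) := a + t * (b - a).
apply: (@le_trans _ _ (curve_length g (c \o l))).
  apply: rdist_le_curve; first exact: subcurve_C1.
    by rewrite /l /= mul0r addr0.
  by rewrite /l /= mul1r addrC subrK.
rewrite -integral_affine//; last exact: speed_continuous.
rewrite /curve_length le_eqVlt; apply/orP; left; apply/eqP.
by apply: eq_integral => t /set_mem t01; rewrite subcurve_speed.
Qed.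

Variables (f : M -> R) (K : R).
Hypothesis K0 : 0 < K.
Hypothesis floc : forall p : M, exists2 U, nbhs p U &
  forall q r, U q -> U r -> (`|f q - f r|%:E <= K%:E * rdist g q r)%E.

Lemma lipschitz_along_curve (c : R -> M) : C1_curve g c ->
  (`|f (c 0) - f (c 1)|%:E <= K%:E * curve_length g c)%E.
Proof.
move=> Cc.
apply: (@interval_chaining R (fun a b : R => `|f (c a) - f (c b)|%:E <=
  K%:E * \int[mu]_(t in `[a, b]) (speed c t)%:E)%E).
- move=> a b d a0 ab bd d1 Pab Pbd.
  rewrite (@integral_itv_split _ a b d)//; last 2 first.
  + exact: speed_continuous.
  + by move=> t; exact: sqrtr_ge0.
  rewrite ge0_muleDr; last 2 first.
  + by apply: integral_ge0 => t _; rewrite lee_fin sqrtr_ge0.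
  + by apply: integral_ge0 => t _; rewrite lee_fin sqrtr_ge0.
  apply: le_trans (leeD Pab Pbd); rewrite -EFinD lee_fin.
  by rewrite -[X in X <= _](_ : `|(f (c a) - f (c b)) + (f (c b) - f (c d))| = _)
    ?ler_normD// addrA subrK.
- move=> t t01; have [cc _ _] := Cc t t01.
  have [U Ut fU] := floc (c t).
  have /nbhs_ballP[d /= d0 dU] : nbhs t (c @^-1` U) := cc U Ut.
  exists d => // a b a0 at_ tb b1 ad bd.
  have Ua : U (c a) by apply: dU; rewrite /ball/= ger0_norm ?subr_ge0.
  have Ub : U (c b) by apply: dU; rewrite /ball/= distrC ger0_norm ?subr_ge0.
  apply: le_trans (fU _ _ Ua Ub) _; apply: lee_wpmul2l.
    by rewrite lee_fin ltW.
  by apply: rdist_le_subcurve => //; exact: le_trans at_ tb.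
Qed.

(** A function that is locally Lipschitz with the same constant [K] around every
    point is [K]-Lipschitz. *)
Lemma locally_uniformly_lipschitz : lipschitz_in g setT f.
Proof.
exists K => // p q _ _.
have chain s : piecewise_C1 g p s q ->
    (`|f p - f q|%:E <= K%:E * \sum_(c <- s) curve_length g c)%E.
  elim: s p => [|c s IH] p /=.
    by move=> ->; rewrite subrr normr0 big_nil mule0.
  move=> [Cc <- /IH h]; rewrite big_cons ge0_muleDr; last 2 first.
  - by apply: integral_ge0 => t _; rewrite lee_fin sqrtr_ge0.
  - apply: sume_ge0 => c' _.
    by apply: integral_ge0 => t _; rewrite lee_fin sqrtr_ge0.
  apply: le_trans (leeD (lipschitz_along_curve Cc) h); rewrite -EFinD lee_fin.
  by rewrite -[X in X <= _](_ : `|(f (c 0) - f (c 1)) + (f (c 1) - f q)| = _)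
    ?ler_normD// addrA subrK.
rewrite -lee_pdivrMl//; apply: le_ereal_inf_tmp => _ [s sp <-].
by rewrite lee_pdivrMl//; exact: chain.
Qed.

End global_lipschitz.

(** * The cutoff function *)

Section derivative_at_max.
Context {R : realType} {V : normedModType R}.

Lemma derive_le0_at_max (f : V -> R) (u v : V) : differentiable f u ->
  (forall w, f w <= f u) -> 'D_v f u <= 0.
Proof.
move=> df fmax; rewrite leNgt; apply/negP => D0.
have cv : h^-1 *: (f (h *: v + u) - f u) @[h --> (0:R)^'] --> 'D_v f u.
  by have := diff_derivable (v := v) df; apply.
have : \forall h \near (0 : R)^', 0 < h^-1 *: (f (h *: v + u) - f u).
  exact: cvgr_gt cv _ D0.
move=> [e /= e0 he].
have := he (e / 2); rewrite /= sub0r normrN ger0_norm; last first.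
  by rewrite divr_ge0// ltW.
rewrite ltr_pdivrMr// ltr_pMr// ltr1n => /(_ isT).
rewrite gt_eqF ?divr_gt0// => /(_ isT); apply/negP; rewrite -leNgt.
by apply: mulr_ge0_le0; rewrite ?subr_le0// invr_ge0 divr_ge0// ltW.
Qed.

Lemma derive_eq0_at_max (f : V -> R) (u v : V) : differentiable f u ->
  (forall w, f w <= f u) -> 'D_v f u = 0.
Proof.
move=> df fmax; apply/eqP; rewrite eq_le derive_le0_at_max//=.
have := derive_le0_at_max (- v) df fmax.
by rewrite !deriveE// linearN oppr_le0.
Qed.

End derivative_at_max.

Section cutoff.
Context {R : realType} {n : nat} {M : ptopologicalType}.
Variable g : riemannian_manifold R n M.

Lemma rdist_ge0 p q : (0 <= rdist g p q)%E.
Proof.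
apply: le_ereal_inf_tmp => _ [s _ <-]; apply: sume_ge0 => c _.
by apply: integral_ge0 => t _; rewrite lee_fin sqrtr_ge0.
Qed.

Lemma tangent_norm0 p : tangent_norm g p 0 = 0.
Proof. by rewrite /tangent_norm !mul0mx mxE sqrtr0. Qed.

Lemma tangent_normN p v : tangent_norm g p (- v) = tangent_norm g p v.
Proof.
by rewrite /tangent_norm linearN/= mulNmx mulmxN mulNmx opprK.
Qed.

(** Either [f] is differentiable at [p] and its derivative vanishes there, or
    [grad f p] is 0 by convention. *)
Lemma grad_norm_at_max (f : M -> R) p : (forall q, f q <= f p) ->
  grad_norm g f p = 0.
Proof.
move=> fmax; rewrite /grad_norm /grad; case: asboolP => df.
  rewrite [X in X *m _](_ : _ = 0) ?mul0mx ?tangent_norm0//.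
  apply/rowP => i; rewrite !mxE; apply: derive_eq0_at_max => // w.
  by rewrite /in_coord /= chartK//; exact: chart_dom_chart_at.
exact: tangent_norm0.
Qed.

(** The test function [min 1 (max 0 (r - rho))]. *)
Definition cutoff (rho : M -> R) (r : R) (p : M) : R :=
  Num.min 1 (Num.max 0 (r - rho p)).

Variables (rho : M -> R) (r : R).
Let phi := cutoff rho r.

Lemma cutoff_le1 p : phi p <= 1.
Proof. by rewrite /phi /cutoff ge_min lexx. Qed.

Lemma cutoff_neq0 p : (phi p != 0) = (rho p < r).
Proof.
rewrite -subr_gt0 /phi /cutoff /Num.min /Num.max; case: (ltP 0 (r - rho p)) => h.
  by case: ifPn => _; rewrite ?oner_eq0// gt_eqF.
by rewrite ltr10 eqxx.
Qed.

Lemma cutoff_eq1 p : rho p <= r - 1 -> phi p = 1.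
Proof.
move=> h; rewrite /phi /cutoff /Num.min /Num.max.
by do ?case: ifPn; rewrite -?leNgt; lra.
Qed.

Lemma cutoff_lipschitz p q : `|phi p - phi q| <= `|rho p - rho q|.
Proof.
have : rho q - rho p <= `|rho p - rho q| by rewrite distrC ler_norm.
have := ler_norm (rho p - rho q); move: `|rho p - rho q| => d h1 h2.
rewrite ler_norml /phi /cutoff /Num.min /Num.max; apply/andP.
by do ?case: ifPn; rewrite -?leNgt => *; split; lra.
Qed.

(** Around [p] the cutoff is [r - rho], at least in coordinates, where the
    differentiability of [rho] gives continuity. *)
Lemma grad_norm_cutoff p : differentiable_at g rho p ->
  r - 1 < rho p -> rho p < r -> grad_norm g phi p <= grad_norm g rho p.
Proof.
move=> drho lo hi; set x := chart_at g p.
have crho := differentiable_continuous drho.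
have rhoE : in_coord g rho p (x p) = rho p.
  by rewrite /in_coord /= chartK//; exact: chart_dom_chart_at.
have E : {near x p, cst r - in_coord g rho p =1 in_coord g phi p}.
  have near_lo : \forall u \near x p, r - 1 < in_coord g rho p u.
    by apply: cvgr_gt crho _ _; rewrite rhoE.
  have near_hi : \forall u \near x p, in_coord g rho p u < r.
    by apply: cvgr_lt crho _ _; rewrite rhoE.
  move: near_lo; apply: filter_app; move: near_hi; apply: filterS => u.
  rewrite /in_coord/= => u1 u2; rewrite /phi /cutoff /Num.min /Num.max.
  by do ?case: ifPn; rewrite ?fctE -?leNgt; lra.
rewrite /grad_norm /grad; case: (asboolP (differentiable_at g phi p)) => dphi.
  rewrite asboolT//.
  rewrite -[leRHS]tangent_normN -mulNmx.
  rewrite (_ : \row_i _ = - \row_i 'D_(delta_mx ord0 i) (in_coord g rho p) (x p))//.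
  apply/rowP => i; rewrite !mxE -(near_eq_derive _ E) deriveB.
  + by rewrite derive_cst sub0r.
  + exact: derivable_cst.
  + exact: diff_derivable.
by rewrite tangent_norm0 sqrtr_ge0.
Qed.

End cutoff.

(** * Energy and mass of the cutoff function *)

Section test_function.
Context {R : realType} {n : nat} {M : ptopologicalType}.
Variable g : riemannian_manifold R n M.
Variables (dV : {measure set (borel M) -> \bar R}) (rho : M -> R).
Let B (r : R) : set M := [set p | rho p < r].
Hypothesis rho_lip : locally_lipschitz g rho.

Lemma cutoff_support r : Defs.support (cutoff rho r) = closure (B r).
Proof.
rewrite /Defs.support; congr closure.
by apply/seteqP; split=> p /=; rewrite cutoff_neq0.
Qed.

(** The property [P K q] below, that [rho] is [K]-Lipschitz near [q], is open in
    [q] and increasing in [K], so that by compactness one [K] serves for all [q]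
    in the closure of [B r]. *)
Lemma cutoff_Lip0 r : precompact (B r) -> Lip0 g (cutoff rho r).
Proof.
rewrite precompactE => cB; split; last by rewrite cutoff_support.
pose P (K : R) (q : M) := exists2 U, nbhs q U & forall p1 p2, U p1 -> U p2 ->
  (`|rho p1 - rho p2|%:E <= K%:E * rdist g p1 p2)%E.
have [K [K0 PK]] : exists K, 0 < K /\ forall q, closure (B r) q -> P K q.
  have /compact_near_coveringP nc := cB.
  have := nc R (pinfty_nbhs R) P _ => /(_ _) near_P.
  have : \forall K \near +oo, forall q, closure (B r) q -> P K q.
    apply: near_P => p _; have [U Up [K _ UK]] := rho_lip p.
    exists (interior U, [set L | K <= L]) => /=.
      by split; [exact: nbhs_interior|apply: nbhs_pinfty_ge; exact: num_real].
    move=> [q L] /= [Uq KL]; exists U => // p1 p2 Up1 Up2.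
    apply: le_trans (UK _ _ Up1 Up2) _.
    by rewrite lee_wpmul2r ?rdist_ge0// lee_fin.
  have pos : \forall K \near +oo, (0 : R) < K.
    by apply: nbhs_pinfty_gt; exact: num_real.
  by move=> /(filterI pos)/filter_ex[K [K0 KP]]; exists K.
apply: (@locally_uniformly_lipschitz _ _ _ g _ K K0) => p.
have [pB|pB] := pselect (closure (B r) p).
  have [U Up UK] := PK p pB; exists U => // p1 p2 Up1 Up2.
  apply: le_trans (UK _ _ Up1 Up2); rewrite lee_fin; exact: cutoff_lipschitz.
exists (~` closure (B r)) => [|p1 p2 p1B p2B].
  by apply: open_nbhs_nbhs; split=> //; exact/closed_openC/closed_closure.
have out q : (~` closure (B r)) q -> cutoff rho r q = 0.
  move=> qB; apply/eqP; apply/negPn/negP; rewrite cutoff_neq0 => rq; apply: qB.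
  exact: subset_closure.
rewrite !out// subrr normr0 mule_ge0 ?rdist_ge0//.
by rewrite lee_fin ltW.
Qed.

Lemma open_sublevel r : open (B r).
Proof.
rewrite (_ : B r = rho @^-1` [set x | x < r])//.
apply: open_comp; last exact: open_lt.
by move=> p _; exact: (locally_lipschitz_continuous rho_lip).
Qed.

Lemma measurable_sublevel r : measurable (B r : set (borel M)).
Proof. by apply: sub_sigma_algebra; exact: open_sublevel. Qed.

Hypothesis rho_grad :
  {ae dV, forall p, differentiable_at g rho p /\ grad_norm g rho p <= 1}.

(** On the complement of [B (r - 1)] the gradient has norm at most 1 outside a
    null set; where [rho <= r - 1], the cutoff is at its maximum 1. *)
Lemma cutoff_energy r :
  (\int[dV]_(p in B r) (grad_norm g (cutoff rho r) p ^+ 2)%:E <=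
   dV (~` B (r - 1)))%E.
Proof.
have [N [mN N0 subN]] := rho_grad.
have mB := measurable_sublevel (r - 1).
have mCB : measurable (~` B (r - 1) : set (borel M)) by exact: measurableC.
(* The norm of the gradient is not known to be measurable, so the null set [N]
   is dealt with by the value +oo in a measurable upper bound. *)
have -> : dV (~` B (r - 1)) = (\int[dV]_p
    ((cst +oo \_ (N : set (borel M))) p + (cst 1 \_ (~` B (r - 1))) p))%E.
  rewrite ge0_integralD//.
  - by rewrite -!integral_mkcond !integral_cst// N0 mule0 add0e mul1e.
  - by move=> p _; apply: erestrict_ge0 => q _; rewrite leey.
  - apply: (proj1 (measurable_restrictT (cst (+oo%E : \bar R)) mN)).
    exact: measurable_cst.
  - by move=> p _; apply: erestrict_ge0 => q _; exact: lee01.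
  - apply: (proj1 (measurable_restrictT (cst (1%E : \bar R)) mCB)).
    exact: measurable_cst.
apply: ge0_le_integral_nomeas => p.
- by rewrite lee_fin sqr_ge0.
- move=> _; apply: adde_ge0; apply: erestrict_ge0 => q _.
    exact: leey.
  exact: lee01.
rewrite !patchE in_setT; case: ifPn => [/set_mem/= pr|_]; last first.
  by apply: adde_ge0; case: ifP => // _; exact: leey.
have [pN|pN] := boolP (p \in (N : set (borel M))).
  by rewrite addye ?leey//; case: ifP.
have [dp gp] : differentiable_at g rho p /\ grad_norm g rho p <= 1.
  by apply: contrapT => h; move/negP: pN; apply; apply/mem_set/subN.
rewrite add0e; have [lo|hi] := leP (rho p) (r - 1).
  rewrite grad_norm_at_max ?expr0n/=; first by case: ifP.
  by move=> q; rewrite [leRHS]cutoff_eq1// cutoff_le1.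
rewrite mem_set; last by apply/negP; rewrite -leNgt ltW.
rewrite lee_fin exprn_ile1 ?sqrtr_ge0//.
by apply: le_trans gp; exact: grad_norm_cutoff.
Qed.

Lemma cutoff_mass r :
  (dV (B (r - 1)) <= \int[dV]_(p in B r) (cutoff rho r p ^+ 2)%:E)%E.
Proof.
rewrite -[leLHS]mul1e -integral_cst//; last exact: measurable_sublevel.
apply: ge0_le_integral_nomeas => p.
- by [].
- by rewrite lee_fin sqr_ge0.
rewrite !patchE; case: ifPn => [/set_mem/= pr|_]; last first.
  by case: ifP => //; rewrite lee_fin sqr_ge0.
rewrite mem_set; last by rewrite /B/= (lt_trans pr)// gtrBl.
by rewrite cutoff_eq1 ?expr1n// ltW.
Qed.

Lemma lambda1_le_ratio r : precompact (B r) -> B r !=set0 ->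
  (lambda1 g dV (B r) <= \int[dV]_(p in B r) (grad_norm g (cutoff rho r) p ^+ 2)%:E /
    \int[dV]_(p in B r) (cutoff rho r p ^+ 2)%:E)%E.
Proof.
move=> cB [p Bp]; apply: ereal_inf_lbound; exists (cutoff rho r) => //=.
by split; [exact: cutoff_Lip0|rewrite cutoff_support|exists p; rewrite cutoff_neq0].
Qed.

End test_function.

(** * Exponential rates *)

Section exponential_rate.
Context {R : realType}.

Lemma lte_between2 (y x : \bar R) : (y < x)%E ->
  exists b1 b2 : R, [/\ (y < b1%:E)%E, b1 < b2 & (b2%:E < x)%E].
Proof.
move: y x => [y| |] [x| |]//= yx.
- exists ((2 * y + x) / 3), ((y + 2 * x) / 3); move: yx; rewrite !lte_fin => yx.
  by split; lra.
- by exists (y + 1), (y + 2); rewrite lte_fin ltry; split=> //; lra.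
- by exists (x - 2), (x - 1); rewrite lte_fin ltNyr; split=> //; lra.
- by exists 0, 1; rewrite ltNyr ltry ltr01.
Qed.

Lemma le_expR_of_lne (x : \bar R) (c : R) : (lne x <= c%:E)%E ->
  (x <= (expR c)%:E)%E.
Proof.
case: x => [x| |]//=; last by move=> _; exact: leNye.
case: ifPn => [x0 _|]; first by rewrite lee_fin (le_trans x0)// expR_ge0.
rewrite -ltNge => x0; rewrite !lee_fin => xc.
by rewrite -[x]lnK ?posrE// ler_expR.
Qed.

Lemma lne_le_ln (x : \bar R) (c : R) : 0 < c -> (x <= c%:E)%E ->
  (lne x <= (ln c)%:E)%E.
Proof.
move=> c0; case: x => [x| |]//=; last by move=> _; exact: leNye.
case: ifPn => [x0 _|]; first exact: leNye.
by rewrite -ltNge => x0; rewrite !lee_fin => xc; rewrite ler_ln.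
Qed.

(** Exponential decay rates are insensitive to a unit shift of the variable and
    to a constant factor. The hypothesis expresses [L r <= V (r - 1) / m] through
    the real upper bounds of [V (r - 1)]. *)
Lemma limf_einf_rate_shift (V L : R -> \bar R) (m : R) : 0 < m ->
  (\forall r \near +oo, forall c : R, (V (r - 1)%R <= c%:E)%E ->
     (L r <= (c / m)%:E)%E) ->
  (limf_einf (fun r : R => - lne (V r) / r%:E) +oo%R <=
   limf_einf (fun r : R => - lne (L r) / r%:E) +oo%R)%E.
Proof.
move=> m0 VL.
have invE (r : R) : 0 < r -> ((r%:E)^-1 = (r^-1)%:E)%E.
  by move=> r0; rewrite inver gt_eqF.
rewrite leNgt; apply/negP => /lte_between2[b1 [b2 [lb1 b12 b2u]]].
move: lb1; rewrite ltNge => /negP; apply.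
move: b2u; rewrite limf_einfE => /ereal_sup_gt[_ [A nA <-] b2A].
have near_V : \forall r \near +oo, (b2%:E <= - lne (V r) / r%:E)%E.
  move: nA; apply: filterS => r Ar; apply: le_trans (ltW b2A) _.
  by apply: ereal_inf_lbound; exists r.
have near_shift : \forall r \near +oo, (b2%:E <= - lne (V (r - 1)%R) / (r - 1)%:E)%E.
  case: near_V => N [Nr hN]; exists (N + 1); split; first exact: num_real.
  by move=> r Nr1; apply: hN; rewrite ltrBrDr.
(* This threshold makes (b2 * (r - 1) + ln m) / r at least b1. *)
have near_large : \forall r \near +oo, [/\ 1 < r & (b2 - ln m) / (b2 - b1) <= r].
  exists (Num.max 1 ((b2 - ln m) / (b2 - b1))); split; first exact: num_real.
  by move=> r; rewrite gt_max => /andP[r1 /ltW r2].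
have near_L : \forall r \near +oo, (b1%:E <= - lne (L r) / r%:E)%E.
  move: VL; apply: filter_app; move: near_shift; apply: filter_app.
  move: near_large; apply: filterS => r [r1 rb] Vr Lr.
  have r10 : 0 < r - 1 by rewrite subr_gt0.
  have r0 : 0 < r by rewrite (lt_trans _ r1).
  have VE : (V (r - 1)%R <= (expR (- (b2 * (r - 1))))%:E)%E.
    apply: le_expR_of_lne; rewrite EFinN leeNr EFinM.
    by rewrite -lee_pdivlMr// -invE.
  have /lne_le_ln := Lr _ VE; rewrite divr_gt0 ?expR_gt0// => /(_ isT).
  rewrite ln_div ?posrE ?expR_gt0// expRK => LE.
  rewrite invE// lee_pdivlMr// leeNr; apply: le_trans LE _.
  rewrite -EFinM -EFinN lee_fin.
  by move: rb; rewrite ler_pdivrMr ?subr_gt0//; nra.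
rewrite limf_einfE; apply: le_ereal_sup_tmp.
exists (ereal_inf [set (- lne (L r) / r%:E)%E | r in
    [set r | (b1%:E <= - lne (L r) / r%:E)%E]]).
  by exists [set r | (b1%:E <= - lne (L r) / r%:E)%E].
by apply: le_ereal_inf_tmp => _ [r br <-].
Qed.

End exponential_rate.

(** * The comparison of the two rates *)

Unset Implicit Arguments.

Theorem proposition1p4 (R : realType) (n : nat) (M : ptopologicalType)
    (g : riemannian_manifold R n M)
    (dV : {measure set (borel M) -> \bar R})
    (rho : M -> R) :
  let B (r : R) : set M := [set p | rho p < r] in
  (2 <= n)%N ->
  riemannian_complete g ->
  ~ compact [set: M] ->
  is_riemannian_volume g dV ->
  (forall p, 0 <= rho p) ->
  locally_lipschitz g rho ->
  (forall r, 0 < r -> precompact (B r)) ->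
  {ae dV, forall p, differentiable_at g rho p /\ grad_norm g rho p <= 1} ->
  (dV [set: M] < +oo)%E ->
  (limf_einf (fun r : R => - lne (dV (~` B r)) / r%:E) +oo%R <=
   limf_einf (fun r : R => - lne (lambda1 g dV (B r)) / r%:E) +oo%R)%E.
Proof.
move=> B _ _ _ _ rho_ge0 rho_lip B_cpt rho_grad dV_fin.
have mB (r : R) : measurable (B r : set (borel M)) := measurable_sublevel rho_lip r.
pose E (r : R) := (\int[dV]_(p in B r) (grad_norm g (cutoff rho r) p ^+ 2)%:E)%E.
pose Q (r : R) := (\int[dV]_(p in B r) (cutoff rho r p ^+ 2)%:E)%E.
have E_ge0 r : (0 <= E r)%E by apply: integral_ge0 => p _; rewrite lee_fin sqr_ge0.
have Q_ge0 r : (0 <= Q r)%E by apply: integral_ge0 => p _; rewrite lee_fin sqr_ge0.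
have near_lambda : \forall r \near +oo, (lambda1 g dV (B r) <= E r / Q r)%E.
  exists (rho point); split; first exact: num_real.
  move=> r ptr; apply: lambda1_le_ratio => //; last by exists point.
  by apply: B_cpt; exact: le_lt_trans ptr.
have [[r0 Br0]|B0] := pselect (exists r0, (0 < dV (B r0))%E).
- have Br0_fin : dV (B r0) \is a fin_num.
    rewrite ge0_fin_numE//; apply: le_lt_trans dV_fin.
    by apply: le_measure; rewrite ?inE//; exact: measurableT.
  apply: (@limf_einf_rate_shift _ _ _ (fine (dV (B r0)))).
    by rewrite fine_gt0// Br0/= ltey_eq Br0_fin.
  have large : \forall r \near +oo, r0 <= r - 1.
    exists (r0 + 1); split; first exact: num_real.
    by move=> r /ltW; rewrite -lerBrDr.
  move: near_lambda; apply: filter_app; move: large; apply: filterS.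
  move=> r r0r lam c Vc; apply: le_trans lam _.
  have m0 : 0 < fine (dV (B r0)) by rewrite fine_gt0// Br0/= ltey_eq Br0_fin.
  have -> : ((c / fine (dV (B r0)))%:E = c%:E * (dV (B r0))^-1)%E.
    by rewrite -{2}(fineK Br0_fin) inver gt_eqF.
  apply: lee_pmul => //; first by rewrite inve_ge0.
    exact: le_trans (cutoff_energy rho_lip rho_grad r) Vc.
  rewrite lee_pV2 ?inE//.
  apply: le_trans (cutoff_mass dV rho_lip r); apply: le_measure.
  - by rewrite inE; exact: mB.
  - by rewrite inE; exact: mB (r - 1).
  - by move=> p /lt_le_trans; apply.
(* Every [B r] is a null set, and the ratio of the integrals is 0 / 0 = 0. *)
- apply: (@limf_einf_rate_shift _ _ _ 1) => //.
  move: near_lambda; apply: filterS => r lam c Vc; apply: le_trans lam _.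
  rewrite divr1; have -> : E r = 0%E.
    apply/eqP; rewrite eq_le E_ge0 andbT.
    have dVB0 : dV (B r) = 0%E.
      apply/eqP; rewrite -measure_le0 leNgt; apply/negP => h.
      by apply: B0; exists r.
    rewrite (_ : 0%E = \int[dV]_(p in B r) (cst +oo p))%E; last first.
      by rewrite integral_cst// dVB0 mule0.
    apply: ge0_le_integral_nomeas => p; rewrite ?lee_fin ?sqr_ge0 ?leey//.
    by rewrite !patchE; case: ifP; rewrite ?leey.
  by rewrite mul0e; apply: le_trans Vc.
Qed.
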